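(* Let $\mathcal{H}$ be a complex Hilbert space, and for every generalized Drazin invertible $S\in\mathcal{B}(\mathcal{H})$ with closed range let a fixed inner inverse $S^{-}$ of $S$ be chosen. Let $\mathcal{PO}$ be the set of all generalized Drazin invertible operators $S\in\mathcal{B}(\mathcal{H})$ with closed range such that $$\|S^d\|\leq1\quad\text{and}\quad\lim_{n\to\infty}\left\|S^{-}S^{n+2}S^d-S^{n+1}S^d\right\|=0.$$ Then the relation $\leq^{-GD}$ is a pre-order (reflexive and transitive) on $\mathcal{PO}$.
   Context: $\mathcal{B}(\mathcal{H})$ is the space of bounded linear operators on $\mathcal{H}$. An operator $Q$ is quasinilpotent if $\|Q^n\|^{1/n}\to0$. $S\in\mathcal{B}(\mathcal{H})$ is generalized Drazin invertible if there is $X\in\mathcal{B}(\mathcal{H})$ with $XSX=X$, $SX=XS$ and $S-S^2X$ quasinilpotent; such an $X$ is unique and is denoted $S^d$. An inner inverse of $S$ is $S^{-}\in\mathcal{B}(\mathcal{H})$ with $SS^{-}S=S$ (one exists iff the range of $S$ is closed). The 1GD inverse of $S$ associated with its fixed inner inverse $S^{-}$ is $S^{-GD}=S^{-}SS^d$. The relation $S\leq^{-GD}T$ means $SS^{-GD}=TS^{-GD}$ and $S^{-GD}S=S^{-GD}T$. *)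

(* Defs.v *)
From HB Require Import structures.
From mathcomp Require Import all_boot all_order all_algebra.
From mathcomp Require Import sesquilinear complex.
From mathcomp Require Import all_classical all_reals all_analysis.

Set Implicit Arguments.
Unset Strict Implicit.
Unset Printing Implicit Defensive.

Import Order.TTheory GRing.Theory Num.Theory.
Import numFieldNormedType.Exports.

Local Open Scope classical_set_scope.
Local Open Scope ring_scope.

(* With `H` complete for its norm, `dot` is the inner product of a Hilbert
   space (linear in its first argument). *)
Definition induces_norm (R : realType) (H : normedModType R[i])
    (dot : {dot H for Num.conj}) : Prop :=
  forall x : H, dot x x = `|x| ^+ 2.

Section BoundedOperators.
Context {R : realType} {H : normedModType R[i]}.

Definition bounded_linear (f : H -> H) : Prop :=
  linear f /\ exists M : R[i], forall x, `|f x| <= M * `|x|.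

Definition bounded_linear_pred : {pred (H -> H)} :=
  fun f => `[< bounded_linear f >].

Lemma bounded_linear_submod : submod_closed bounded_linear_pred.
Proof.
split.
  apply/asboolP; split=> [a x y|]; first by rewrite /= scaler0 addr0.
  by exists 0 => x; rewrite mul0r normr0.
move=> a f g /asboolP[lf [M fM]] /asboolP[lg [N gN]]; apply/asboolP; split.
  move=> b x y; rewrite !fctE lf lg !scalerDr !scalerA (mulrC a b).
  by rewrite -!addrA; congr (_ + _); rewrite addrCA.
exists (`|a| * M + N) => x; rewrite !fctE mulrDl.
apply: (le_trans (ler_normD _ _)); rewrite normrZ -mulrA.
by apply: lerD; rewrite ?ler_wpM2l.
Qed.

HB.instance Definition _ :=
  GRing.isSubmodClosed.Build R[i] (H -> H) bounded_linear_pred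
    bounded_linear_submod.

Record bounded_operator : Type :=
  BoundedOperator { bop_fun :> H -> H; bop_funP : bop_fun \in bounded_linear_pred }.

HB.instance Definition _ := [isSub for bop_fun].
HB.instance Definition _ := [Choice of bounded_operator by <:].
HB.instance Definition _ :=
  [SubChoice_isSubLmodule of bounded_operator by <:].

End BoundedOperators.

Arguments bounded_operator {R} H.
Notation "''B' ( H )" := (bounded_operator H)
  (at level 8, format "''B' ( H )") : type_scope.

Section OperatorRing.
Context {R : realType} {H : normedModType R[i]}.
Implicit Types S T : 'B(H).

Lemma bopP S : bounded_linear S.
Proof. exact/asboolP/bop_funP. Qed.

Lemma bop_linear S : linear S.
Proof. by have [] := bopP S. Qed.

HB.instance Definition _ S := GRing.isLinear.Build R[i] H H *:%R S (bop_linear S).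

Lemma bop_id_subproof : (idfun : H -> H) \in bounded_linear_pred.
Proof. by apply/asboolP; split=> //; exists 1 => x; rewrite mul1r. Qed.

Lemma bop_comp_subproof S T : (S \o T : H -> H) \in bounded_linear_pred.
Proof.
have [_ [M SM]] := bopP S; have [_ [N TN]] := bopP T.
apply/asboolP; split; first by move=> a x y; rewrite /= !linearP.
exists (`|M| * N) => x /=; apply: (le_trans (SM _)); rewrite -mulrA.
have [->|Tx0] := eqVneq (T x) 0; first by
  rewrite normr0 mulr0 mulr_ge0//; exact: le_trans (normr_ge0 _) (TN x).
have M0 : 0 <= M.
  by rewrite -(pmulr_lge0 _ (_ : 0 < `|T x|)) ?normr_gt0// (le_trans _ (SM _)).
by rewrite ger0_norm// ler_wpM2l.
Qed.

Definition bop_one : 'B(H) := BoundedOperator bop_id_subproof.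
Definition bop_mul S T : 'B(H) := BoundedOperator (bop_comp_subproof S T).

Lemma bop_ext S T : S =1 T -> S = T.
Proof. by move=> eqST; apply/val_inj/funext. Qed.

Fact bop_mulA : associative bop_mul.
Proof. by move=> S T U; apply: bop_ext. Qed.
Fact bop_mul1l : left_id bop_one bop_mul.
Proof. by move=> S; apply: bop_ext. Qed.
Fact bop_mul1r : right_id bop_one bop_mul.
Proof. by move=> S; apply: bop_ext. Qed.
Fact bop_mulDl : left_distributive bop_mul +%R.
Proof. by move=> S T U; apply: bop_ext. Qed.
Fact bop_mulDr : right_distributive bop_mul +%R.
Proof. by move=> S T U; apply: bop_ext => x; exact: linearD. Qed.

(* The ring product is composition. The ring may be trivial: `H` is allowed to
   be the zero space. *)
HB.instance Definition _ := GRing.Zmodule_isPzRing.Build 'B(H)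
  bop_mulA bop_mul1l bop_mul1r bop_mulDl bop_mulDr.

(* Norms on `H` take (nonnegative real) values in `R[i]`; `complex.Re` brings
   them back to `R`. *)
Definition opnorm S : R :=
  sup [set complex.Re `|S x| | x in [set x : H | `|x| <= 1]].

Definition quasinilpotent S : Prop :=
  opnorm (S ^+ n) `^ n%:R^-1 @[n --> \oo] --> (0 : R).

Definition is_gdrazin S X : Prop :=
  [/\ X * S * X = X, S * X = X * S & quasinilpotent (S - S ^+ 2 * X)].

Definition gdrazin_invertible S : Prop := exists X, is_gdrazin S X.

(* Meaningful for generalized Drazin invertible `S`, where the inverse is
   unique; the default value 0 is taken otherwise. *)
Definition gdrazin S : 'B(H) := xget 0 [set X | is_gdrazin S X].

Definition is_inner_inverse S X : Prop := S * X * S = S.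

Definition gdrazin_closed_range : set 'B(H) :=
  [set S | gdrazin_invertible S /\ closed (range S)].

Section FixedInnerInverses.
Variable inner : 'B(H) -> 'B(H).

Definition inv1GD S : 'B(H) := inner S * S * gdrazin S.

Definition le1GD S T : Prop :=
  S * inv1GD S = T * inv1GD S /\ inv1GD S * S = inv1GD S * T.

Definition PO : set 'B(H) :=
  [set S | [/\ gdrazin_closed_range S,
    opnorm (gdrazin S) <= 1 &
    opnorm (inner S * S ^+ (n + 2) * gdrazin S - S ^+ (n + 1) * gdrazin S)
      @[n --> \oo] --> (0 : R)]].

End FixedInnerInverses.
End OperatorRing.

Definition preorder_on (T : Type) (A : set T) (r : T -> T -> Prop) : Prop :=
  (forall x, A x -> r x x) /\
  (forall x y z, A x -> A y -> A z -> r x y -> r y z -> r x z).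

(* Main.v *)
Require Import Defs.
From HB Require Import structures.
From mathcomp Require Import all_boot all_order all_algebra.
From mathcomp Require Import sesquilinear complex.
From mathcomp Require Import all_classical all_reals all_analysis.

Set Implicit Arguments.
Unset Strict Implicit.
Unset Printing Implicit Defensive.

Import Order.TTheory GRing.Theory Num.Theory.
Import numFieldNormedType.Exports.

Local Open Scope classical_set_scope.
Local Open Scope ring_scope.

(* Since [X = gdrazin S] is a contraction and [S ^+ n * X ^+ n.+1 = X], the limit
   condition defining [PO] forces [inner S * S * X = X], so that the 1GD inverse
   is [X] itself and the relation [S <= T] reads [S * X = T * X], [X * S = X * T].
   Then [T] commutes with [X] and [X = T ^+ n * X ^+ n.+1]; as [T - T ^+ 2 * Y] is
   quasinilpotent for [Y = gdrazin T], this gives [T * Y * X = X = X * T * Y],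
   from which transitivity is pure algebra. *)

Section OperatorNorm.
Context {R : realType} {H : normedModType R[i]}.
Implicit Types S T X : 'B(H).

Lemma normr_complexE (x : H) : `|x| = (complex.Re `|x|)%:C%C.
Proof. by apply/esym/RRe_real; rewrite normr_real. Qed.

Lemma Re_norm_ge0 (x : H) : 0 <= complex.Re `|x|.
Proof. by rewrite -ler0c -normr_complexE. Qed.

Lemma opnorm_has_sup S :
  has_sup [set complex.Re `|S x| | x in [set x : H | `|x| <= 1]].
Proof.
split; first by exists (complex.Re `|S 0|), 0 => //=; rewrite normr0.
have [_ [M SM]] := bopP S.
(* On the zero space the bound [M] may be any complex number, hence the modulus. *)
exists (complex.Re `|M|) => _ [x /= x1 <-].
have : `|S x| <= `|M|.
  rewrite -[`|S x|]normr_id; apply: le_trans (_ : `|M * `|x| | <= _).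
    by rewrite normr_id [leRHS]ger0_norm// (le_trans _ (SM x)).
  by rewrite normrM normr_id ler_piMr.
by rewrite lecE => /andP[].
Qed.

Lemma opnorm_ge0 S : 0 <= opnorm S.
Proof.
apply: le_trans (Re_norm_ge0 (S 0)) _.
by apply: ub_le_sup; [have [] := opnorm_has_sup S|exists 0 => //=; rewrite normr0].
Qed.

Lemma le_opnorm S x : `|S x| <= (opnorm S)%:C%C * `|x|.
Proof.
have [->|x0] := eqVneq x 0; first by rewrite linear0 !normr0 mulr0.
have nx0 : 0 < `|x| by rewrite normr_gt0.
rewrite -ler_pdivrMr// mulrC.
have -> : `|x|^-1 * `|S x| = `|S (`|x|^-1 *: x)|.
  by rewrite linearZ normrZ normfV normr_id.
rewrite normr_complexE lecR; apply: ub_le_sup; first by have [] := opnorm_has_sup S.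
by exists (`|x|^-1 *: x) => //=; rewrite normrZ normfV normr_id mulVf// gt_eqF.
Qed.

Lemma opnorm_le S (c : R) : 0 <= c ->
  (forall x, `|S x| <= c%:C%C * `|x|) -> opnorm S <= c.
Proof.
move=> c0 Sc; apply: ge_sup; first by have [] := opnorm_has_sup S.
move=> _ [x /= x1 <-]; rewrite -lecR -normr_complexE; apply: le_trans (Sc x) _.
by rewrite ler_piMr// ler0c.
Qed.

Lemma opnormM S T : opnorm (S * T) <= opnorm S * opnorm T.
Proof.
apply: opnorm_le => [|x]; first by rewrite mulr_ge0 ?opnorm_ge0.
apply: le_trans (le_opnorm S (T x)) _.
by rewrite rmorphM -mulrA ler_wpM2l ?le_opnorm// ler0c opnorm_ge0.
Qed.

(** Equality fails on the zero space, where the identity has norm 0. *)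
Lemma opnorm1 : opnorm (1 : 'B(H)) <= 1.
Proof. by apply: opnorm_le => // x; rewrite mul1r. Qed.

Lemma opnormX_le1 S n : opnorm S <= 1 -> opnorm (S ^+ n) <= 1.
Proof.
move=> S1; elim: n => [|n IHn]; first exact: opnorm1.
rewrite exprS; apply: le_trans (opnormM _ _) _.
by rewrite mulr_ile1 ?opnorm_ge0.
Qed.

Lemma opnorm_le0 S : opnorm S <= 0 -> S = 0.
Proof.
move=> S0; apply: bop_ext => x; apply/eqP; rewrite -normr_le0.
have := le_opnorm S x.
have -> : opnorm S = 0 by apply/eqP; rewrite eq_le S0 opnorm_ge0.
by rewrite mul0r.
Qed.

(** Turns a limit into an exact identity: [S] does not depend on [n], so a null sequence can
    dominate its norm only if [S] vanishes. *)
Lemma eq0_opnorm_cvg S (u : nat -> R) :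
  (\forall n \near \oo, opnorm S <= u n) -> u n @[n --> \oo] --> (0 : R) ->
  S = 0.
Proof.
move=> Su u0; apply: opnorm_le0; rewrite -(cvg_lim (@Rhausdorff R) u0).
by apply: limr_ge => //; apply/cvg_ex; exists 0.
Qed.

(** Once the [n]-th root [r] of the norm is at most 1, the norm [r ^+ n] is at most [r], which tends
    to 0. *)
Lemma quasinilpotent_cvg S : quasinilpotent S ->
  opnorm (S ^+ n) @[n --> \oo] --> (0 : R).
Proof.
move=> qS; apply: (squeeze_cvgr _ (cvg_cst _) qS).
near=> n; rewrite opnorm_ge0 /=.
have n0 : (0 < n)%N by near: n; exact: nbhs_infty_gt.
have n0' : n%:R != 0 :> R by rewrite pnatr_eq0 -lt0n.
have le1 : opnorm (S ^+ n) `^ n%:R^-1 <= 1.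
  by near: n; apply: (cvgr_le _ qS); exact: ltr01.
rewrite -[leLHS]powRr1 ?opnorm_ge0// -[X in _ `^ X](mulVf n0') powRrM.
rewrite powR_mulrn ?powR_ge0// -[leRHS]expr1.
by rewrite ler_wiXn2l// powR_ge0.
Unshelve. all: by end_near. Qed.

End OperatorNorm.

Section GDrazin.
Context {R : realType} {H : normedModType R[i]}.
Implicit Types S T X Y : 'B(H).

Lemma gdrazinP S : gdrazin_invertible S -> is_gdrazin S (gdrazin S).
Proof. by case=> X SX; apply: (@xgetPex _ 0 [set X | is_gdrazin S X]); exists X. Qed.

(** Since [S * X * X = X], each extra [S] cancels one extra [X]. Quasinilpotence is left out so that
    this also serves a pair [T], [X] where [X] comes from another operator. *)
Lemma gdrazin_mulXX S X n : X * S * X = X -> S * X = X * S ->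
  S ^+ n * X * X ^+ n = X.
Proof.
move=> XSX SX; have SXX : S * X * X = X by rewrite SX.
elim: n => [|n IHn]; first by rewrite mul1r mulr1.
by rewrite exprSr exprS mulrA -2!(mulrA (S ^+ n)) SXX.
Qed.

(* Multiplying the [n]-th term of the limit on the right by the contraction
   [gdrazin S ^+ n.+1] gives an operator independent of [n]. *)
Lemma inv1GD_PO (inner : 'B(H) -> 'B(H)) S : PO inner S ->
  inv1GD inner S = gdrazin S.
Proof.
case=> -[/gdrazinP[]]; set X := gdrazin S => XSX SX _ _ X1 lim0.
apply/eqP; rewrite -subr_eq0 /inv1GD -/X; apply/eqP.
apply: (eq0_opnorm_cvg _ lim0); near=> n.
have -> : inner S * S * X - X =
    (inner S * S ^+ (n + 2) * X - S ^+ (n + 1) * X) * X ^+ (n + 1).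
  rewrite mulrBl gdrazin_mulXX// addn2 addn1 exprS -!mulrA.
  by rewrite [S ^+ _ * (X * _)]mulrA gdrazin_mulXX.
apply: le_trans (opnormM _ _) _.
by rewrite ler_piMr ?opnorm_ge0 ?opnormX_le1.
Unshelve. all: by end_near. Qed.

(** The defect is [T] times the idempotent [1 - T * Y], which commutes with [T]. The exponent is
    positive because the zeroth power is 1, not [1 - T * Y]. *)
Lemma gdrazin_defectX T Y n : Y * T * Y = Y -> T * Y = Y * T ->
  (T - T ^+ 2 * Y) ^+ n.+1 = T ^+ n.+1 * (1 - T * Y).
Proof.
move=> YTY TY.
have cTP : GRing.comm T (1 - T * Y).
  by rewrite /GRing.comm mulrBr mulrBl mulr1 mul1r -mulrA TY.
have idP : (1 - T * Y) * (1 - T * Y) = 1 - T * Y.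
  by rewrite mulrBr mulr1 mulrBl mul1r -mulrA (mulrA Y) YTY subrr subr0.
have -> : T - T ^+ 2 * Y = T * (1 - T * Y) by rewrite mulrBr mulr1 mulrA.
rewrite exprMn_comm//; congr (_ * _).
by elim: n => [|n IHn]; rewrite ?expr1// exprS IHn.
Qed.

(* The defect [(1 - T * Y) * X] equals [(T - T ^+ 2 * Y) ^+ n * X ^+ n.+1] for all
   [n > 0], and this tends to 0. *)
Lemma gdrazin_absorb T X Y : is_gdrazin T Y -> opnorm X <= 1 ->
  T * X = X * T -> X * T * X = X -> T * Y * X = X /\ X * T * Y = X.
Proof.
case=> YTY TY /quasinilpotent_cvg lim0 X1 TX XTX.
have cPT n : T ^+ n * (1 - T * Y) = (1 - T * Y) * T ^+ n.
  apply/esym/commrX.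
  by rewrite /GRing.comm mulrBr mulrBl mulr1 mul1r -mulrA TY.
(* Mirror form of the cancellation, for multiplying the defect on the left by [X]. *)
have XT n : X = X ^+ n.+1 * T ^+ n.
  rewrite -[LHS](gdrazin_mulXX n XTX)// -mulrA -exprS.
  exact/commrX/commr_sym/commrX.
split; apply/esym/eqP; rewrite -subr_eq0; apply/eqP.
  have -> : X - T * Y * X = (1 - T * Y) * X by rewrite mulrBl mul1r.
  apply: (eq0_opnorm_cvg _ lim0); near=> n.
  have -> : (1 - T * Y) * X = (T - T ^+ 2 * Y) ^+ n * X ^+ n.+1.
    have n0 : (0 < n)%N by near: n; exact: nbhs_infty_gt.
    rewrite -(prednK n0) gdrazin_defectX// prednK// cPT -mulrA exprS.
    by rewrite (mulrA (T ^+ n)) gdrazin_mulXX.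
  apply: le_trans (opnormM _ _) _.
  by rewrite ler_piMr ?opnorm_ge0 ?opnormX_le1.
have -> : X - X * T * Y = X * (1 - T * Y) by rewrite mulrBr mulr1 mulrA.
apply: (eq0_opnorm_cvg _ lim0); near=> n.
have -> : X * (1 - T * Y) = X ^+ n.+1 * (T - T ^+ 2 * Y) ^+ n.
  have n0 : (0 < n)%N by near: n; exact: nbhs_infty_gt.
  by rewrite {1}(XT n) -(prednK n0) gdrazin_defectX// prednK// mulrA.
apply: le_trans (opnormM _ _) _.
by rewrite ler_piMl ?opnorm_ge0 ?opnormX_le1.
Unshelve. all: by end_near. Qed.

End GDrazin.

Theorem corollary5 (R : realType) (H : completeNormedModType R[i])
    (dot : {dot H for Num.conj}) (Hdot : induces_norm dot)
    (inner : 'B(H) -> 'B(H))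
    (Hinner : forall S : 'B(H),
       gdrazin_closed_range S -> is_inner_inverse S (inner S)) :
  preorder_on (PO inner) (le1GD inner).
Proof.
split=> [S PS|S T U PS PT PU]; rewrite /le1GD (inv1GD_PO PS).
  by split.
rewrite (inv1GD_PO PT).
have [[/gdrazinP[XSX SX _] _] X1 _] := PS.
have [[/gdrazinP GT _] _ _] := PT; have [_ TY _] := GT.
move: (gdrazin S) (gdrazin T) XSX SX X1 GT TY => X Y XSX SX X1 GT TY.
move=> [SXTX XSXT] [TYUY YTYU].
(* [T * X = S * X = X * S = X * T], and hence [X * T * X = X * S * X = X]. *)
have [TYX XTY] : T * Y * X = X /\ X * T * Y = X.
  by apply: gdrazin_absorb; rewrite -?SXTX -?XSXT.
split.
  (* Writing [X] as [Y * T * X] puts [Y] next to [U]: [U * X = U * Y * T * X = T * Y * T * X = T *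
     X]. *)
  rewrite SXTX -[in RHS]TYX TY -(mulrA Y) (mulrA U) -TYUY -(mulrA T).
  by rewrite (mulrA Y) -TY TYX.
(* Dually, [X * U = X * T * Y * U = X * T * Y * T = X * T]. *)
by rewrite XSXT -[in RHS]XTY -(mulrA (X * T)) -YTYU (mulrA (X * T)) XTY.
Qed.
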